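(* Let $n\ge2$ and $1\le k\le n-1$ be integers. Let $G=(V,E)$ be the graph with vertex set $V=\binom{[n]}{k}$ (the size-$k$ subsets of $[n]=\{1,\dots,n\}$, identified with the vectors in $\{0,1\}^n$ of Hamming weight $k$) and with an edge between $x,y\in V$ if and only if $\|x-y\|_1=2$. Let $\mathcal X=V$, $\mathcal Y=E$, $\pi=\mathrm{Unif}(\mathcal X)$, $K:\mathcal X\to\mathcal Y$, $K(x,e)=\frac1{k(n-k)}\mathbf 1\{x\in e\}$, and $P=KK_\pi^*$ (the lazy random walk on $G$: $P(x,x)=\frac12$ and $P(x,y)=\frac1{2k(n-k)}$ for $\{x,y\}\in E$). Then $$\alpha(\pi,K)=O\left(\frac1{\log\binom nk}\right)\qquad\text{and}\qquad\delta(\pi,P)\ge\frac n{2k(n-k)}.$$ In particular, for constant $k\ge1$, $\frac{\delta(\pi,P)}{\alpha(\pi,K)}=\Omega(\log n)$ as $n\to\infty$.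
   Context: A Markov kernel $K:\mathcal X\to\mathcal Y$ between finite sets is a nonnegative matrix $(K(x,y))$ with rows summing to $1$; $(\nu K)(y)=\sum_x\nu(x)K(x,y)$. The reverse kernel is $K_\pi^*(y,x)=\frac{\pi(x)K(x,y)}{(\pi K)(y)}$ if $(\pi K)(y)>0$ and $K_\pi^*(y,x)=\pi(x)$ otherwise. $D(\nu\|\pi)=\sum_x\nu(x)\log\frac{\nu(x)}{\pi(x)}$ is the KL divergence (natural logarithm, $0\log0=0$, $+\infty$ if $\nu\not\ll\pi$). Half-step entropy contraction coefficient: $\alpha(\pi,K)=1-\sup_{\nu:\,0<D(\nu\|\pi)<\infty}\frac{D(\nu K\|\pi K)}{D(\nu\|\pi)}$. Full-step entropy contraction coefficient: $\delta(\pi,P)=1-\sup_{\nu:\,0<D(\nu\|\pi)<\infty}\frac{D(\nu P\|\pi)}{D(\nu\|\pi)}$. In both, $\nu$ ranges over probability distributions on $\mathcal X$. The constant in the $O$ bound is universal (independent of $n,k$); the constant in the final $\Omega$ may depend on $k$ but not on $n$. *)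

(* Defs.v *)
From HB Require Import structures.
From mathcomp Require Import all_boot all_order all_algebra.
From mathcomp Require Import all_classical all_reals all_analysis.
From mathcomp Require Import zify ring lra.

Set Implicit Arguments.
Unset Strict Implicit.
Unset Printing Implicit Defensive.

Import Order.TTheory GRing.Theory Num.Theory.

Local Open Scope classical_set_scope.
Local Open Scope ring_scope.

Section Kernels.
Context {R : realType}.
Implicit Types X Y Z : finType.

Definition is_dist X (nu : X -> R) : Prop :=
  (forall x, 0 <= nu x) /\ \sum_x nu x = 1.

Definition is_kernel X Y (K : X -> Y -> R) : Prop :=
  forall x, is_dist (K x).

Definition push X Y (nu : X -> R) (K : X -> Y -> R) : Y -> R :=
  fun y => \sum_x nu x * K x y.

Definition kcomp X Y Z (K : X -> Y -> R) (L : Y -> Z -> R) : X -> Z -> R :=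
  fun x z => \sum_y K x y * L y z.

Definition reverse X Y (pi : X -> R) (K : X -> Y -> R) : Y -> X -> R :=
  fun y x => if 0 < push pi K y then pi x * K x y / push pi K y else pi x.

(* The convention 0 log 0 = 0 comes from multiplication by nu x = 0. *)
Definition KL X (nu pi : X -> R) : \bar R :=
  if [forall x, (pi x == 0) ==> (nu x == 0)]
  then (\sum_x nu x * ln (nu x / pi x))%:E else +oo%E.

Definition KL_finite_pos X (pi : X -> R) : set (X -> R) :=
  [set nu | is_dist nu /\ (0 < KL nu pi < +oo)%E].

Definition half_step X Y (pi : X -> R) (K : X -> Y -> R) : \bar R :=
  (1 - ereal_sup [set KL (push nu K) (push pi K) / KL nu pi
                 | nu in KL_finite_pos pi])%E.

Definition full_step X (pi : X -> R) (P : X -> X -> R) : \bar R :=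
  (1 - ereal_sup [set KL (push nu P) pi / KL nu pi
                 | nu in KL_finite_pos pi])%E.

Definition uniform X : X -> R := fun=> #|X|%:R^-1.

End Kernels.

Section Johnson.
Variables n k : nat.

Definition johnson_vertex : finType := {x : {set 'I_n} | #|x| == k}.

(* The l^1 distance of the 0/1 indicator vectors of x and y. *)
Definition l1_dist (x y : {set 'I_n}) : int :=
  \sum_(i < n) `|(i \in x)%:Z - (i \in y)%:Z|.

Definition johnson_adj (x y : johnson_vertex) : bool :=
  l1_dist (val x) (val y) == 2.

Definition johnson_edge : finType :=
  {e : {set johnson_vertex} |
    [exists x, exists y, johnson_adj x y && (e == [set x; y]%SET)]}.

End Johnson.

Section JohnsonKernels.
Variables (R : realType) (n k : nat).

Definition johnson_pi : johnson_vertex n k -> R := @uniform R (johnson_vertex n k).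

Definition johnson_K : johnson_vertex n k -> johnson_edge n k -> R :=
  fun x e => (x \in val e)%:R / (k%:R * (n%:R - k%:R)).

Definition johnson_P : johnson_vertex n k -> johnson_vertex n k -> R :=
  kcomp johnson_K (reverse johnson_pi johnson_K).

End JohnsonKernels.

Section JohnsonFacts.
Variables (R : realType) (n k : nat).
Local Notation V := (johnson_vertex n k).
Local Notation E := (johnson_edge n k).
Implicit Types (x y z : V) (e : E).
Local Open Scope nat_scope.

Lemma l1_distE (x y : {set 'I_n}) : l1_dist x y = (#|x :\: y| + #|y :\: x|)%:Z.
Proof.
have h (A : {set 'I_n}) : (#|A|%:Z = \sum_(i < n) (i \in A)%:Z)%R.
  rewrite -sum1_card big_mkcond /=.
  rewrite (big_morph Posz PoszD (erefl _)).
  by apply: eq_bigr => i _; case: (i \in A).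
rewrite PoszD !h -big_split /=; apply: eq_bigr => i _.
by rewrite !inE; case: (i \in x); case: (i \in y).
Qed.

Lemma johnson_adj_sym x y : johnson_adj x y = johnson_adj y x.
Proof. by rewrite /johnson_adj !l1_distE addnC. Qed.

Lemma johnson_adj_irrefl x : johnson_adj x x = false.
Proof. by rewrite /johnson_adj l1_distE finset.setDv cards0. Qed.

Lemma johnson_adj_neq x y : johnson_adj x y -> x != y.
Proof. by apply: contraTneq => ->; rewrite johnson_adj_irrefl. Qed.

Lemma johnson_adjP x y :
  reflect (exists a b, [/\ a \in val x, b \notin val x &
             val y = (b |: (val x :\ a))%SET]) (johnson_adj x y).
Proof.
have cx : #|val x| = k by apply/eqP; apply: (valP x).
have cy : #|val y| = k by apply/eqP; apply: (valP y).
have cE : #|val x :\: val y| = #|val y :\: val x|.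
  by rewrite !cardsD finset.setIC cx cy.
rewrite /johnson_adj l1_distE cE; apply: (iffP eqP).
- move=> h; have c1 : #|val y :\: val x| == 1 by lia.
  have /cards1P[b hb] := c1.
  have /cards1P[a ha] : #|val x :\: val y| == 1 by rewrite cE.
  have mb i := congr1 (fun A : {set 'I_n} => i \in A) hb.
  have ma i := congr1 (fun A : {set 'I_n} => i \in A) ha.
  exists a, b; split.
  + by have := ma a; rewrite !inE eqxx => /andP[].
  + by have := mb b; rewrite !inE eqxx => /andP[].
  + apply/setP => i; have := ma i; have := mb i; rewrite !inE => <- <-.
    by case: (i \in val x); case: (i \in val y).
- move=> [a [b [ax bx yE]]].
  suff -> : (val y :\: val x = [set b])%SET by rewrite cards1.
  apply/setP => i; rewrite yE !inE; case: (eqVneq i b) => [->|_] /=.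
    by rewrite bx.
  by case: (i \in val x); rewrite ?andbF.
Qed.

Lemma johnson_deg x : #|[set y | johnson_adj x y]%SET| = k * (n - k).
Proof.
have cx : #|val x| = k by apply/eqP; apply: (valP x).
pose f (p : 'I_n * 'I_n) : V := insubd x (p.2 |: (val x :\ p.1))%SET.
have fE a b : a \in val x -> b \notin val x ->
    val (f (a, b)) = (b |: (val x :\ a))%SET.
  move=> ax bx; rewrite /f val_insubd /= cardsU1 !inE negb_and bx orbT.
  by move: cx; rewrite add1n (cardsD1 a (val x)) ax add1n => ->; rewrite eqxx.
have -> : ([set y | johnson_adj x y] = f @: finset.setX (val x) (~: val x))%SET.
  apply/setP => y; rewrite inE; apply/johnson_adjP/imsetP.
  - move=> [a [b [ax bx yE]]]; exists (a, b); first by rewrite !inE ax bx.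
    by apply: val_inj; rewrite fE.
  - move=> [[a b]]; rewrite !inE /= => /andP[ax bx] ->.
    by exists a, b; split => //; rewrite fE.
rewrite card_in_imset.
  by have := cardsC (val x); rewrite cardsX cx card_ord => h; congr (_ * _); exact: (esym (canLR (addKn k) (esym h))).
move=> [a b] [c d]; rewrite !inE /= => /andP[ax bx] /andP[cx' dx].
move=> /(congr1 val); rewrite !fE // => /setP h.
have bd : b = d.
  have := h b; rewrite !inE eqxx /= (negbTE bx) andbF orbF => /esym/eqP//.
have := h a; rewrite !inE eqxx ax /= orbF !andbT bd => ac.
congr (_, _) => //; apply/eqP.
have ad : a != d by apply: contraNneq dx => <-.
by move: ac; rewrite (negbTE ad) /= => /esym/negbFE.
Qed.

Lemma johnson_edgeP (S : {set V}) :
  reflect (exists x y, johnson_adj x y /\ S = [set x; y]%SET)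
   [exists x, exists y, johnson_adj x y && (S == [set x; y]%SET)].
Proof.
apply: (iffP existsP) => [[x /existsP[y /andP[h /eqP->]]]|[x [y [h ->]]]].
  by exists x, y.
by exists x; apply/existsP; exists y; rewrite h eqxx.
Qed.

Lemma johnson_edge_mem e x : x \in val e ->
  exists2 y, johnson_adj x y & val e = [set x; y]%SET.
Proof.
have /johnson_edgeP[u [v [uv ->]]] := valP e.
rewrite !inE => /orP[]/eqP->; first by exists v.
by exists u; rewrite 1?johnson_adj_sym // finset.setUC.
Qed.

Lemma card_johnson_edge e : #|val e| = 2.
Proof.
have /johnson_edgeP[x [y [xy ->]]] := valP e.
by rewrite cards2 johnson_adj_neq.
Qed.

Definition common_edges x y : {set E} :=
  [set e : E | (x \in val e) && (y \in val e)]%SET.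

Lemma card_common_edges x y : #|common_edges x y| =
  if x == y then k * (n - k) else johnson_adj x y.
Proof.
rewrite -(card_imset _ (@val_inj _ _ E)); case: eqVneq => [<-|xy].
- rewrite -(johnson_deg x) -(@card_in_imset _ _ (fun z => [set x; z]%SET)).
    congr (#|pred_of_set _|); apply/setP => S; apply/imsetP/imsetP.
    + move=> [e]; rewrite inE andbb => /johnson_edge_mem[z xz eE] ->.
      by exists z; rewrite ?inE.
    + move=> [z]; rewrite inE => xz ->.
      have p : [exists u, exists v, johnson_adj u v && ([set x; z]%SET == [set u; v]%SET)].
        by apply/johnson_edgeP; exists x, z.
      by exists (exist _ [set x; z]%SET p); rewrite ?inE /= ?inE ?eqxx.
  move=> u z; rewrite !inE => xu xz /setP/(_ u).
  rewrite !inE eqxx orbT => /esym/orP[/eqP ux|/eqP//].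
  by rewrite ux johnson_adj_irrefl in xu.
- case: (boolP (johnson_adj x y)) => [adj|nadj] /=.
  + apply/eqP/cards1P; exists [set x; y]%SET.
    apply/setP => S; rewrite inE; apply/imsetP/eqP.
    * move=> [e]; rewrite inE => /andP[/johnson_edge_mem[z xz eE]].
      rewrite eE !inE => /orP[|/eqP yz ->]; first by rewrite eq_sym (negbTE xy).
      by rewrite yz.
    * move=> ->.
      have p : [exists u, exists v, johnson_adj u v && ([set x; y]%SET == [set u; v]%SET)].
        by apply/johnson_edgeP; exists x, y.
      by exists (exist _ [set x; y]%SET p); rewrite ?inE /= ?inE ?eqxx ?orbT.
  + apply/eqP; rewrite cards_eq0; apply/eqP; apply/setP => S; rewrite inE.
    apply/negbTE; apply/imsetP => -[e]; rewrite inE => /andP[/johnson_edge_mem[z xz eE]].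
    rewrite eE !inE => /orP[/eqP yx|/eqP yz _]; first by rewrite yx eqxx in xy.
    by rewrite -yz (negbTE nadj) in xz.
Qed.

Hypothesis hk : 1 <= k <= n - 1.
Local Open Scope ring_scope.

Let dE : k%:R * (n%:R - k%:R) = (k * (n - k))%:R :> R.
Proof. by rewrite natrM natrB//; move: hk; lia. Qed.

Let d_neq0 : k%:R * (n%:R - k%:R) != 0 :> R.
Proof. by rewrite dE pnatr_eq0 muln_eq0; move: hk; lia. Qed.

Let d_ge0 : 0 <= k%:R * (n%:R - k%:R) :> R.
Proof. by rewrite dE ler0n. Qed.

Lemma johnson_K_kernel : is_kernel (@johnson_K R n k).
Proof.
move=> x; split=> [e|]; first by rewrite divr_ge0 ?ler0n.
transitivity (#|common_edges x x|%:R / (k%:R * (n%:R - k%:R)) : R).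
  rewrite -mulr_suml; congr (_ / _).
  rewrite -sum1_card natr_sum [RHS]big_mkcond; apply: eq_bigr => e _.
  by rewrite inE andbb; case: ifP.
by rewrite card_common_edges eqxx -dE divff.
Qed.

Lemma johnson_PE x y : johnson_P R x y =
  if x == y then 2^-1 else (johnson_adj x y)%:R / (2 * (k%:R * (n%:R - k%:R))).
Proof.
set d := k%:R * (n%:R - k%:R).
have N0 : #|{: V}|%:R != 0 :> R by rewrite pnatr_eq0 -lt0n; apply/card_gt0P; exists x.
have N_gt0 : 0 < #|{: V}|%:R :> R by rewrite lt0r N0 ler0n.
have d_gt0 : 0 < d by rewrite lt0r d_neq0 d_ge0.
have pE e : push (@johnson_pi R n k) (@johnson_K R n k) e = #|{: V}|%:R^-1 * (2 / d).
  rewrite /push /johnson_pi /uniform -mulr_sumr; congr (_ * _).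
  rewrite -mulr_suml; congr (_ / _); rewrite -(card_johnson_edge e) -sum1_card.
  by rewrite natr_sum [RHS]big_mkcond; apply: eq_bigr => z _; case: ifP.
have rE e z : reverse (@johnson_pi R n k) (@johnson_K R n k) e z = (z \in val e)%:R / 2.
  rewrite /reverse pE ifT; last by apply: mulr_gt0; [rewrite invr_gt0 | apply: divr_gt0].
  rewrite /johnson_pi /uniform /johnson_K -/d; field.
  by rewrite N0 /= gt_eqF.
rewrite /johnson_P /kcomp.
have -> : \sum_e johnson_K R x e * reverse (@johnson_pi R n k) (@johnson_K R n k) e y =
   #|common_edges x y|%:R / (2 * d).
  rewrite -sum1_card natr_sum [X in _ = X / _]big_mkcond mulr_suml.
  apply: eq_bigr => e _; rewrite rE inE /johnson_K -/d.
  by case: (x \in val e); case: (y \in val e); rewrite ?mul0r ?mulr0 // !mul1r -invfM mulrC.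
rewrite card_common_edges; case: ifP => // _.
by rewrite -dE -/d invfM mulrCA divff ?mulr1.
Qed.

End JohnsonFacts.

(* Main.v *)
Require Import Defs.
From HB Require Import structures.
From mathcomp Require Import all_boot all_order all_algebra perm.
From mathcomp Require Import all_classical all_reals all_analysis.
From mathcomp Require Import zify ring lra.

Set Implicit Arguments.
Unset Strict Implicit.
Unset Printing Implicit Defensive.

Import Order.TTheory GRing.Theory Num.Theory.
Import numFieldNormedType.Exports.

Local Open Scope ring_scope.

(**
Write [f = N nu] for the density of [nu] with respect to the uniform law on
the [N] vertices.

Full step.  Fix [lambda > 1 - kappa], [kappa = n / 2k(n-k)], and consider
[F f = Ent (P f) - lambda Ent f].  Linearising the convex part [Ent (P f)] at
[f] and maximising exactly gives [f' = exp (P (ln (P f)) / lambda)], normalised,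
and [F f <= F f'].  If neighbours [x, y] are exchanged by the transposition
[s], then coupling the walks from [x] and [y] by [z |-> s z] never increases
the distance, so [f |-> P f] does not increase the Lipschitz constant of the
logarithm; and it coalesces with probability [kappa], so [P] contracts Lipschitz
constants by [1 - kappa].  Hence the iteration contracts the Lipschitz constant
of [ln f] geometrically, while [F f] is at most a multiple of that constant, so
[F <= 0].

Half step.  [D(nu||pi) - D(nu K||pi K)] is a sum over edges of two-point entropy
gaps.  At a Dirac mass the ratio is [1 - ln 2 / ln N].  Each gap dominates
[(f x - f y)^2 / 6N], so connectedness gives a positive, [n]-dependent lower
bound on the coefficient: the final ratio is not a division by zero.
*)

(** * Entropy of densities relative to the uniform law *)

Definition entropy (R : realType) (X : finType) (f : X -> R) : R :=
  \sum_x f x * ln (f x).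

Definition kact (R : realType) (X : finType) (P : X -> X -> R) (f : X -> R) :
  X -> R := fun x => \sum_z P x z * f z.

Definition edge_lipschitz (R : realType) (X : finType) (e : rel X) (L : R)
    (phi : X -> R) : Prop :=
  forall x y, e x y -> phi x - phi y <= L.

Section Entropy.
Context {R : realType} {X : finType}.
Implicit Types (f g h : X -> R) (P : X -> X -> R).

Lemma ln_le_subr1 (x : R) : 0 < x -> ln x <= x - 1.
Proof.
by move=> x0; have := @le_ln1Dx R (x - 1); rewrite addrCA subrr addr0; apply; lra.
Qed.

(** Sum [ln u <= u - 1] at [u = h x / f x]; the linear terms cancel because the masses agree. This
    is the variational formula for entropy, used below both as a tangent bound and as an exact
    maximisation. *)
Lemma gibbs f h : (forall x, 0 <= f x) -> (forall x, 0 < h x) ->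
  \sum_x h x = \sum_x f x -> \sum_x f x * ln (h x) <= entropy f.
Proof.
move=> f0 h0 hf; rewrite -subr_le0 /entropy -sumrB.
apply: (@le_trans _ _ (\sum_x (h x - f x))); last by rewrite sumrB hf subrr.
apply: ler_sum => x _.
have := f0 x; rewrite le_eqVlt => /predU1P[<-|fx].
  by rewrite !mul0r subrr subr0 ltW.
have := ln_le_subr1 (divr_gt0 (h0 x) fx); rewrite ln_div ?posrE// => H.
have : f x * (ln (h x) - ln (f x)) <= f x * (h x / f x - 1) by rewrite ler_pM2l.
have -> : f x * (h x / f x - 1) = h x - f x by field; rewrite gt_eqF.
by rewrite mulrBr.
Qed.

Lemma entropy_ge0 f : (forall x, 0 <= f x) -> \sum_x f x = #|X|%:R ->
  0 <= entropy f.
Proof.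
move=> f0 fN; have := @gibbs f (fun=> 1) f0 (fun=> ltr01).
rewrite fN sumr_const => /(_ erefl); apply: le_trans.
by rewrite big1// => x _; rewrite ln1 mulr0.
Qed.

Lemma sum_kact P f : (forall x, \sum_z P x z = 1) ->
  (forall x y, P x y = P y x) -> \sum_x kact P f x = \sum_x f x.
Proof.
move=> P1 Ps; rewrite /kact exchange_big; apply: eq_bigr => z _ /=.
rewrite -mulr_suml -[RHS]mul1r -(P1 z); congr (_ * _).
by apply: eq_bigr.
Qed.

Lemma sum_mul_kact P f h : (forall x y, P x y = P y x) ->
  \sum_x kact P f x * h x = \sum_x f x * kact P h x.
Proof.
move=> Ps; under eq_bigr do rewrite mulr_suml.
rewrite exchange_big; apply: eq_bigr => z _ /=.
by rewrite mulr_sumr; apply: eq_bigr => x _; rewrite (Ps x z); ring.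
Qed.

Lemma kact_ge0 P f : (forall x z, 0 <= P x z) -> (forall x, 0 <= f x) ->
  forall x, 0 <= kact P f x.
Proof. by move=> P0 f0 x; apply: sumr_ge0 => z _; rewrite mulr_ge0. Qed.

Lemma kact_gt0 P f : (forall x z, 0 <= P x z) -> (forall x, \sum_z P x z = 1) ->
  (forall x, 0 < f x) -> forall x, 0 < kact P f x.
Proof.
move=> P0 P1 f0 x; rewrite lt_def kact_ge0// ?andbT; last by move=> z; exact: ltW.
apply/eqP => /psumr_eq0P H.
have := P1 x; rewrite big1 => [/eqP|z _]; first by rewrite eq_sym oner_eq0.
have /eqP := H (fun z _ => mulr_ge0 (P0 x z) (ltW (f0 z))) z isT.
by rewrite mulf_eq0 (gt_eqF (f0 z)) orbF => /eqP.
Qed.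

Lemma kact_affine P f (a b : R) : (forall x, \sum_z P x z = 1) ->
  forall x, kact P (fun z => a * f z + b) x = a * kact P f x + b.
Proof.
move=> P1 x; rewrite /kact mulr_sumr -[X in _ + X]mulr1 -(P1 x) mulr_sumr -big_split.
by apply: eq_bigr => z _ /=; ring.
Qed.

(** Split the outer factor of [h ln h] along the mixture and apply Gibbs to [h] against [f], then
    against the constant density 1, whose entropy is 0. *)
Lemma entropy_mix_le f (t : R) : 0 < t <= 1 ->
  (forall x, 0 <= f x) -> \sum_x f x = #|X|%:R ->
  entropy (fun x => (1 - t) * f x + t) <= (1 - t) * entropy f.
Proof.
move=> t01 f0 fN; set h := fun x => (1 - t) * f x + t.
have h0 x : 0 < h x.
  by rewrite /h; have : 0 <= (1 - t) * f x; [rewrite mulr_ge0//; lra|lra].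
have hN : \sum_x h x = #|X|%:R.
  by rewrite big_split/= -mulr_sumr fN sumr_const -mulr_natr; ring.
have H1 := gibbs f0 h0 (etrans hN (esym fN)).
have H2 := @gibbs (fun=> 1) h (fun=> ler01) h0.
rewrite hN sumr_const /entropy ln1 in H2.
have {}H2 := H2 erefl; rewrite [X in _ <= X]big1 in H2; last by move=> *; rewrite mulr0.
have -> : entropy h = (1 - t) * (\sum_x f x * ln (h x)) + t * \sum_x 1 * ln (h x).
  rewrite /entropy !mulr_sumr -big_split; apply: eq_bigr => x _ /=.
  by rewrite {1}/h; ring.
have : (1 - t) * (\sum_x f x * ln (h x)) <= (1 - t) * entropy f.
  by rewrite ler_wpM2l//; lra.
have : t * (\sum_x 1 * ln (h x)) <= 0 by rewrite mulr_ge0_le0//; lra.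
by lra.
Qed.

(** Explicit continuity at the boundary: it carries the contraction from positive to nonnegative
    densities without a limit. The mixing weight is a square so that the loss
    [s ln s = 2t (t ln t) >= -2t] is linear in [t]. *)
Lemma entropy_mix_ge f (t : R) : 0 < t < 1 ->
  (forall x, 0 <= f x) -> \sum_x f x = #|X|%:R ->
  (1 - t ^+ 2) * entropy f - #|X|%:R * (t ^+ 2 + 2 * t)
    <= entropy (fun x => (1 - t ^+ 2) * f x + t ^+ 2).
Proof.
move=> t01 f0 fN; set s := t ^+ 2.
have s0 : 0 < s by rewrite exprn_gt0//; lra.
have s1 : s < 1 by rewrite expr_lt1//; lra.
have lt : t * ln t >= t - 1.
  have t0 : 0 < t by lra.
  have := ln_le_subr1 (_ : 0 < t^-1); rewrite invr_gt0 lnV ?posrE// => /(_ t0) H.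
  have : t * - ln t <= t * (t^-1 - 1) by rewrite ler_pM2l.
  by rewrite mulrBr divff ?gt_eqF//; lra.
have ls : s * ln s >= - (2 * t).
  rewrite /s lnXn; last lra.
  have : t * (t * ln t) >= t * (t - 1) by rewrite ler_pM2l//; lra.
  rewrite expr2 mulr2n; nra.
have l1s : (1 - s) * ln (1 - s) >= - s.
  have p : 0 < 1 - s by lra.
  have := ln_le_subr1 (_ : 0 < (1 - s)^-1); rewrite invr_gt0 lnV ?posrE// => /(_ p) H.
  have : (1 - s) * - ln (1 - s) <= (1 - s) * ((1 - s)^-1 - 1) by rewrite ler_pM2l.
  by rewrite mulrBr divff ?gt_eqF//; lra.
have -> : (1 - s) * entropy f - #|X|%:R * (s + 2 * t) =
  \sum_x ((1 - s) * (f x * ln (f x)) - f x * s - 2 * t).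
  by rewrite !sumrB -mulr_suml fN sumr_const -mulr_natr -mulr_sumr -/(entropy f); ring.
apply: ler_sum => x _.
have := f0 x; rewrite le_eqVlt => /predU1P[<-|fx].
  by rewrite !(mul0r, mulr0, add0r, subr0, oppr0).
(* Since [u] exceeds both of its summands, monotonicity of [ln] bounds [u ln u] below termwise. *)
set u := (1 - s) * f x + s.
have vx : 0 < (1 - s) * f x by rewrite mulr_gt0//; lra.
have u1 : ln ((1 - s) * f x) <= ln u by rewrite ler_ln ?posrE /u; lra.
have u2 : ln s <= ln u by rewrite ler_ln ?posrE /u; lra.
have a1 : (1 - s) * f x * ln ((1 - s) * f x) <= (1 - s) * f x * ln u by rewrite ler_pM2l.
have a2 : s * ln s <= s * ln u by rewrite ler_pM2l.
rewrite lnM ?posrE// in a1; last lra.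
have a3 : f x * ((1 - s) * ln (1 - s)) >= f x * - s by rewrite ler_pM2l.
have -> : u * ln u = (1 - s) * f x * ln u + s * ln u by rewrite {1}/u; ring.
by lra.
Qed.

End Entropy.

(** * Entropy contraction from Lipschitz contraction *)

Lemma le0_of_le_geometric (R : realType) (x a r : R) :
  0 <= r < 1 -> (forall m, x <= r ^+ m * a) -> x <= 0.
Proof.
move=> r01 H.
have cv : ((a * r ^+ m)%R @[m --> \oo] --> (0 : R))%classic.
  by apply: cvg_geometric; rewrite ger0_norm; lra.
rewrite -(cvg_lim _ cv)//; apply: limr_ge; first exact: cvgP cv.
by apply: nearW => m; rewrite mulrC.
Qed.

Section EntropyContraction.
Context {R : realType} {X : finType} (e : rel X) (P : X -> X -> R) (c D : R).
Implicit Types (f g phi : X -> R) (L : R).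
Hypothesis P_ge0 : forall x z, 0 <= P x z.
Hypothesis P_sum1 : forall x, \sum_z P x z = 1.
Hypothesis P_sym : forall x y, P x y = P y x.
Hypothesis e_diam : forall phi L, 0 <= L -> edge_lipschitz e L phi ->
  forall x y, phi x - phi y <= D * L.
(** Kantorovich dual form of Wasserstein contraction at rate [c]. *)
Hypothesis P_wasserstein : forall phi L, 0 <= L -> edge_lipschitz e L phi ->
  edge_lipschitz e (c * L) (kact P phi).
(* Dual form of a coupling under which neighbours stay at distance at most 1. *)
Hypothesis P_curvature : forall f L, 0 <= L -> (forall x, 0 < f x) ->
  edge_lipschitz e L (fun x => ln (f x)) ->
  edge_lipschitz e L (fun x => ln (kact P f x)).

(* One step of the majorisation-minimisation scheme for
   [entropy (P f) - lambda * entropy f]: linearise the convex function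
   [entropy (P f)] at [f] and maximise exactly. *)
Lemma entropy_gap_step f L (lambda : R) : 0 < lambda -> 0 <= L ->
  (forall x, 0 < f x) -> \sum_x f x = #|X|%:R ->
  edge_lipschitz e L (fun x => ln (f x)) ->
  exists g, [/\ forall x, 0 < g x, \sum_x g x = #|X|%:R,
    edge_lipschitz e (c / lambda * L) (fun x => ln (g x)) &
    entropy (kact P f) - lambda * entropy f
      <= entropy (kact P g) - lambda * entropy g].
Proof.
move=> l0 L0 f0 fN fL; have [X0|/card_gt0P[x0 _]] := posnP #|X|.
  exists f; split => //.
  by move=> x; exfalso; move: (card0_eq X0 x); rewrite inE.
have N0 : 0 < #|X|%:R :> R by rewrite ltr0n; apply/card_gt0P; exists x0.
pose psi := kact P (fun x => ln (kact P f x)).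
pose Z := \sum_x expR (psi x / lambda).
have Z0 : 0 < Z.
  rewrite /Z (bigD1 x0)//= ltr_pwDl ?expR_gt0//.
  by apply: sumr_ge0 => x _; exact: expR_ge0.
(* [b] normalises [g] to total mass [#|X|]. *)
pose b := ln (#|X|%:R / Z).
pose g x := expR (psi x / lambda + b).
have gE x : ln (g x) = psi x / lambda + b by rewrite /g expRK.
have g0 x : 0 < g x by exact: expR_gt0.
have gN : \sum_x g x = #|X|%:R.
  rewrite /g; under eq_bigr do rewrite expRD.
  by rewrite -mulr_suml -/Z /b lnK ?posrE ?divr_gt0// mulrC divfK// gt_eqF.
have Pf0 := kact_gt0 P_ge0 P_sum1 f0.
have Pg0 := kact_gt0 P_ge0 P_sum1 g0.
have lgE x : lambda * ln (g x) = psi x + lambda * b.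
  by rewrite gE; field; rewrite gt_eqF.
exists g; split => //.
- move=> x y exy; rewrite !gE.
  have := P_wasserstein L0 (P_curvature L0 f0 fL) exy; rewrite -/psi => H.
  have -> : psi x / lambda + b - (psi y / lambda + b) = (psi x - psi y) / lambda by ring.
  by rewrite mulrAC ler_pM2r// invr_gt0.
(* With F the gap functional: [F f = <f, psi> - lambda Ent f <= -lambda b #|X|] by Gibbs, the right
   side equals [<g, psi> - lambda Ent g], and this is at most [F g] by the tangent bound [H1]. *)
- have H1 : \sum_x g x * psi x <= entropy (kact P g).
    rewrite -sum_mul_kact//; apply: gibbs => // [x|]; first exact: ltW.
    by rewrite !sum_kact// fN gN.
  have H2 : \sum_x f x * ln (g x) <= entropy f.
    by apply: gibbs => // [x|]; [exact: ltW|rewrite fN gN].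
  have H3 : entropy (kact P f) = \sum_x f x * psi x by rewrite -sum_mul_kact.
  have H4 h : \sum_x h x = #|X|%:R ->
      lambda * (\sum_x h x * ln (g x)) = \sum_x h x * psi x + lambda * b * #|X|%:R.
    move=> hN; rewrite mulr_sumr -hN mulr_sumr -big_split; apply: eq_bigr => x _ /=.
    by rewrite mulrCA lgE; ring.
  have : lambda * (\sum_x f x * ln (g x)) <= lambda * entropy f by rewrite ler_pM2l.
  rewrite (H4 _ fN).
  have := H4 _ gN; rewrite -/(entropy g) => ->.
  by rewrite H3; lra.
Qed.

(** The term in [entropy f] is dropped by sign. [P f] has mean 1, hence is at most 1 somewhere, so
    [ln (P f) <= D L] everywhere. *)
Lemma entropy_gap_bound f L (lambda : R) : 0 < lambda -> 0 <= L ->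
  (forall x, 0 < f x) -> \sum_x f x = #|X|%:R ->
  edge_lipschitz e L (fun x => ln (f x)) ->
  entropy (kact P f) - lambda * entropy f <= L * (D * #|X|%:R).
Proof.
move=> l0 L0 f0 fN fL.
have Pf0 := kact_gt0 P_ge0 P_sum1 f0.
have PfN : \sum_x kact P f x = #|X|%:R by rewrite sum_kact.
have H1 : 0 <= lambda * entropy f.
  by rewrite mulr_ge0 ?entropy_ge0// ?ltW// => x; exact: ltW.
suff H2 : entropy (kact P f) <= L * (D * #|X|%:R) by lra.
rewrite -PfN !mulr_sumr; apply: ler_sum => x _.
have -> : L * (D * kact P f x) = kact P f x * (D * L) by ring.
rewrite ler_pM2l//.
have [y Hy] : exists y, kact P f y <= 1.
  apply/not_existsP => H.
  have : \sum_(y : X) (1 : R) < \sum_y kact P f y.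
    apply: ltr_sum; first by apply/hasP; exists x => //; rewrite mem_index_enum.
    by move=> y _; rewrite ltNge; apply/negP/H.
  by rewrite PfN sumr_const ltxx.
have := e_diam L0 (P_curvature L0 f0 fL) x y.
by have := ln_le0 Hy; lra.
Qed.

Lemma entropy_contraction_pos f : 0 <= c -> (forall x, 0 < f x) ->
  \sum_x f x = #|X|%:R -> entropy (kact P f) <= c * entropy f.
Proof.
move=> c0 f0 fN.
have [L L0 fL] : exists2 L, 0 <= L & edge_lipschitz e L (fun x => ln (f x)).
  exists (\sum_x \sum_y `|ln (f x) - ln (f y)|).
    by do 2![apply: sumr_ge0 => ? _].
  move=> x y _; apply: (le_trans (ler_norm _)).
  rewrite (bigD1 x)//= (bigD1 y)//= -addrA lerDl addr_ge0 ?sumr_ge0// => z _.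
  by rewrite sumr_ge0.
(* Each iteration multiplies the Lipschitz constant by [c / lambda < 1], so after [m] steps the
   crude bound carries the factor [(c / lambda) ^ m]. *)
have H (lambda : R) : c < lambda -> entropy (kact P f) - lambda * entropy f <= 0.
  move=> cl; have l0 : 0 < lambda by lra.
  apply: (@le0_of_le_geometric _ _ (L * (D * #|X|%:R)) (c / lambda)).
    by rewrite divr_ge0 ?(ltW l0)//= ltr_pdivrMr// mul1r.
  move=> m; elim: m f L f0 fN L0 fL => [|m IH] f L f0 fN L0 fL.
    by rewrite expr0 mul1r; exact: entropy_gap_bound.
  have [g [g0 gN gL]] := entropy_gap_step l0 L0 f0 fN fL.
  move=> /le_trans; apply.
  have r0 : 0 <= c / lambda * L by rewrite mulr_ge0 ?divr_ge0 ?(ltW l0).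
  apply: (le_trans (IH g _ g0 gN r0 gL)).
  by rewrite exprSr -!mulrA.
have E0 : 0 <= entropy f by apply: entropy_ge0 => // x; exact: ltW.
apply/ler_addgt0Pr => eps eps0.
(* Lets [lambda = c + d] approach [c] with total error below [eps]; the summand 1 covers zero
   entropy. *)
pose d := eps / (1 + entropy f).
have d0 : 0 < d by rewrite divr_gt0//; lra.
have dE : d * (1 + entropy f) = eps by rewrite divfK//; lra.
have cd : c < c + d by lra.
have := H _ cd; lra.
Qed.

Theorem entropy_contraction f : 0 <= c -> (forall x, 0 <= f x) ->
  \sum_x f x = #|X|%:R -> entropy (kact P f) <= c * entropy f.
Proof.
move=> c0 f0 fN.
have Pf0 := kact_ge0 P_ge0 f0.
have PfN : \sum_x kact P f x = #|X|%:R by rewrite sum_kact.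
have H (t : R) : 0 < t < 1 ->
    (1 - t ^+ 2) * (entropy (kact P f) - c * entropy f) <= #|X|%:R * (t ^+ 2 + 2 * t).
  move=> t01.
  have s0 : 0 < t ^+ 2 by rewrite exprn_gt0//; lra.
  have s1 : t ^+ 2 < 1 by rewrite expr_lt1//; lra.
  pose h x := (1 - t ^+ 2) * f x + t ^+ 2.
  have h0 x : 0 < h x.
    by rewrite /h; have : 0 <= (1 - t ^+ 2) * f x; [rewrite mulr_ge0//; lra|lra].
  have hN : \sum_x h x = #|X|%:R.
    by rewrite big_split/= -mulr_sumr fN sumr_const -mulr_natr; ring.
  have H1 := entropy_contraction_pos c0 h0 hN.
  have H2 : entropy h <= (1 - t ^+ 2) * entropy f.
    by apply: entropy_mix_le => //; lra.
  have H3 := entropy_mix_ge t01 Pf0 PfN.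
  (* [P] fixes constants, so it commutes with mixing. *)
  have H4 : entropy (kact P h) = entropy (fun x => (1 - t ^+ 2) * kact P f x + t ^+ 2).
    by apply: eq_bigr => x _; rewrite kact_affine.
  have H5 : c * entropy h <= c * ((1 - t ^+ 2) * entropy f) by rewrite ler_wpM2l.
  by rewrite H4 in H1; lra.
rewrite -subr_le0; set G := _ - _ in H *.
have [//|G0] := leP G 0.
have N0 : 0 <= #|X|%:R :> R by [].
(* For this [t < 1/2] the left side of [H] exceeds [3G/4], while the right side is at most
   [3 #|X| t <= G/2]: a contradiction. *)
pose t := G / (2 * (G + 3 * #|X|%:R + 1)).
have q0 : 0 < G + 3 * #|X|%:R + 1 by lra.
have tE : t * (2 * (G + 3 * #|X|%:R + 1)) = G by rewrite divfK//; lra.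
have t0 : 0 < t by rewrite divr_gt0//; lra.
have t1 : t < 1 / 2 by nra.
have t01 : 0 < t < 1 by lra.
have := H t t01.
have : t ^+ 2 < t / 2 by nra.
by nra.
Qed.

End EntropyContraction.

(** * Transpositions acting on the Johnson graph *)

Section JohnsonGraph.
Context {n k : nat}.
Local Notation V := (johnson_vertex n k).
Implicit Types (x y z : V) (a b i j : 'I_n).

Lemma card_swap_set a b x : #|(tperm a b @: val x)%SET| == k.
Proof. by rewrite card_imset ?(valP x)//; exact: perm_inj. Qed.

Definition swap a b x : V :=
  exist (fun A : {set 'I_n} => #|A| == k) _ (card_swap_set a b x).

Lemma mem_swap a b x i : (i \in val (swap a b x)) = (tperm a b i \in val x).
Proof. by rewrite /= -{1}(tpermK a b i) mem_imset//; exact: perm_inj. Qed.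

Lemma swapK a b : involutive (swap a b).
Proof.
by move=> x; apply/val_inj/setP => i; rewrite !mem_swap tpermK.
Qed.

Lemma swap_inj a b : injective (swap a b).
Proof. exact: inv_inj (swapK a b). Qed.

Lemma johnson_adj_swap a b x y :
  johnson_adj (swap a b x) (swap a b y) = johnson_adj x y.
Proof.
rewrite /johnson_adj /l1_dist; congr (_ == _).
rewrite [RHS](reindex_inj (@perm_inj _ (tperm a b))).
by apply: eq_bigr => i _; rewrite !mem_swap.
Qed.

Lemma swap_id a b x : (a \in val x) = (b \in val x) -> swap a b x = x.
Proof.
by move=> abx; apply/val_inj/setP => i; rewrite mem_swap; case: tpermP => // ->.
Qed.

Lemma adj_swap a b x : a \in val x -> b \notin val x ->
  johnson_adj x (swap a b x).
Proof.
move=> ax bx; apply/johnson_adjP; exists a, b; split => //.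
apply/setP => i; rewrite mem_swap !inE; case: tpermP => [->|->|/eqP/negbTE-> /eqP/negbTE->//].
  by rewrite eqxx (negbTE bx) orbF; apply/esym/eqP => E; rewrite -E ax in bx.
by rewrite eqxx ax.
Qed.

Lemma swapC a b x : swap a b x = swap b a x.
Proof. by apply/val_inj/setP => i; rewrite !mem_swap tpermC. Qed.

Lemma swap_id_or_adj a b x : swap a b x = x \/ johnson_adj x (swap a b x).
Proof.
have [ax|ax] := boolP (a \in val x); have [bx|bx] := boolP (b \in val x).
- by left; apply: swap_id; rewrite ax bx.
- by right; exact: adj_swap.
- by right; rewrite swapC; exact: adj_swap.
- by left; apply: swap_id; rewrite (negbTE ax) (negbTE bx).
Qed.

Lemma adjE_swap x y : johnson_adj x y ->
  exists a b, [/\ a \in val x, b \notin val x & y = swap a b x].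
Proof.
move=> /johnson_adjP[a [b [ax bx yE]]]; exists a, b; split => //.
apply/val_inj/setP => i; rewrite mem_swap yE !inE.
case: tpermP => [->|->|/eqP/negbTE-> /eqP/negbTE->//].
  by rewrite eqxx (negbTE bx) orbF; apply/eqP => E; rewrite -E ax in bx.
by rewrite eqxx ax.
Qed.

(** Exchanging a point of [x] outside [y] for a point of [y] outside [x] is one edge and shrinks the
    difference by one. The crude diameter [n] suffices: it enters only auxiliary constants. *)
Lemma johnson_diam (R : realType) (phi : V -> R) (L : R) : 0 <= L ->
  edge_lipschitz (@johnson_adj n k) L phi ->
  forall x y, phi x - phi y <= n%:R * L.
Proof.
move=> L0 phiL x y.
have card_val (u : V) : #|val u| = k by apply/eqP; exact: (valP u).
suff: forall m u, (#|val u :\: val y| <= m)%N -> phi u - phi y <= m%:R * L.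
  by apply; rewrite -[leqRHS]card_ord max_card.
move=> {x}; elim=> [|m IH] x.
  rewrite leqn0 cards_eq0 finset.setD_eq0 => xy.
  have -> : x = y by apply/val_inj/eqP; rewrite eqEcard xy !card_val leqnn.
  by rewrite subrr mul0r.
move=> xym; have [xy|] := boolP (val x \subset val y).
  have -> : x = y by apply/val_inj/eqP; rewrite eqEcard xy !card_val leqnn.
  by rewrite subrr mulr_ge0.
move=> /subsetPn[a ax ay].
have /subsetPn[b yb xb] : ~~ (val y \subset val x).
  apply/negP => yx; move: ay.
  have /eqP -> : val y == val x by rewrite eqEcard yx !card_val leqnn.
  by rewrite ax.
have := phiL _ _ (adj_swap ax xb).
have : phi (swap a b x) - phi y <= m%:R * L.
  apply: IH; rewrite -ltnS; apply: leq_trans xym.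
  apply: proper_card; apply/properP; split.
    apply/fintype.subsetP => i; rewrite !inE mem_swap => /andP[iy].
    case: tpermP => [->|E|_ _ ->]; first by rewrite (negbTE xb).
      by rewrite E yb in iy.
    by rewrite iy.
  exists a; rewrite !inE ?ax ?ay//= mem_swap tpermL (negbTE xb).
  by [].
by rewrite -natr1; lra.
Qed.

Lemma card_johnson_vertex : #|{: V}| = 'C(n, k).
Proof.
rewrite card_sig -[in RHS](card_ord n) -card_draws cardsE.
exact: eq_card.
Qed.

(* The neighbours of [x] left invariant by the swap: adding to [x] an outside
   point in place of [a], or [b] in place of an inside point. *)
Lemma card_fixed_neighbors a b x : a \in val x -> b \notin val x ->
  (n - 2 <= #|[set z | johnson_adj x z && (swap a b z == z)]%SET|)%N.
Proof.
move=> ax bx; set F := [set z | _]%SET.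
have ab : a != b by apply: contraNneq bx => <-.
pose w j := if j \in val x then swap j b x else swap a j x.
have -> : (n - 2)%N = #|(~: [set a; b])%SET|.
  by rewrite cardsCs finset.setCK cards2 ab card_ord.
(* Away from [a] and [b], [w j] differs from [x] exactly at [j], so [w] is injective on the
   complement of [{a, b}]. *)
have wE i j : i != a -> i != b -> (i \in val (w j)) = ((i \in val x) (+) (i == j)).
  move=> ia ib; rewrite /w; case: ifP => jx; rewrite mem_swap.
  - case: tpermP => [->|E|/eqP/negbTE-> _]; rewrite ?addbF//.
      by rewrite eqxx jx (negbTE bx).
    by rewrite E eqxx in ib.
  - case: tpermP => [E|->|_ /eqP/negbTE->]; rewrite ?addbF//.
      by rewrite E eqxx in ia.
    by rewrite eqxx jx ax.
rewrite -(@card_in_imset _ _ w); last first.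
  move=> i j; rewrite !inE !negb_or => /andP[ia ib] _ /(congr1 (fun z : V => i \in val z)).
  by rewrite !wE// eqxx => /addbI/esym/eqP.
apply/subset_leq_card/fintype.subsetP => z /imsetP[j]; rewrite !inE !negb_or => /andP[ja jb] ->.
rewrite /w; case: ifPn => jx; rewrite adj_swap//=; apply/eqP/swap_id; rewrite !mem_swap.
  by rewrite tpermR jx tpermD // eq_sym.
by rewrite tpermL (negbTE jx) tpermD ?(negbTE bx).
Qed.

End JohnsonGraph.

(** * Coupling of the lazy walk by transpositions *)

Section JohnsonWalk.
Context {R : realType} {n k : nat}.
Hypothesis hk : (1 <= k <= n - 1)%N.
Local Notation V := (johnson_vertex n k).
Local Notation P := (@johnson_P R n k).
Implicit Types (x y z : V).

Let d : R := (k * (n - k))%:R.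

Let dE : k%:R * (n%:R - k%:R) = d.
Proof. by rewrite /d natrM natrB//; move: hk; lia. Qed.

Let d_ge1 : 1 <= d.
Proof. by rewrite /d ler1n muln_gt0; move: hk; lia. Qed.

Let PE x y : P x y = if x == y then 2^-1 else (johnson_adj x y)%:R / (2 * d).
Proof. by rewrite johnson_PE// dE. Qed.

Lemma johnson_P_ge0 x y : 0 <= P x y.
Proof. by rewrite PE; case: ifP => // _; rewrite divr_ge0// mulr_ge0//; lra. Qed.

Lemma johnson_P_sym x y : P x y = P y x.
Proof. by rewrite !PE eq_sym johnson_adj_sym. Qed.

Lemma johnson_P_sum1 x : \sum_z P x z = 1.
Proof.
rewrite (bigD1 x)//= PE eqxx.
have -> : \sum_(z | z != x) P x z = \sum_z (johnson_adj x z)%:R / (2 * d).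
  rewrite [RHS](bigD1 x)//= johnson_adj_irrefl mul0r add0r.
  by apply: eq_bigr => z zx; rewrite PE eq_sym (negbTE zx).
rewrite -mulr_suml.
have -> : \sum_z (johnson_adj x z)%:R = d :> R.
  rewrite /d -(johnson_deg x) -sum1_card natr_sum [RHS]big_mkcond.
  by apply: eq_bigr => z _; rewrite inE; case: johnson_adj.
have d0 : d != 0 by rewrite gt_eqF//; apply: lt_le_trans d_ge1.
by rewrite invfM mulrCA divff//; lra.
Qed.

Lemma johnson_P_swap a b x z : P (swap a b x) (swap a b z) = P x z.
Proof. by rewrite !PE (inj_eq (@swap_inj _ _ a b)) johnson_adj_swap. Qed.

Lemma kact_johnson_swap a b (f : V -> R) x :
  kact P f (swap a b x) = \sum_z P x z * f (swap a b z).
Proof.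
rewrite /kact (reindex_inj (@swap_inj _ _ a b)).
by apply: eq_bigr => z _; rewrite johnson_P_swap.
Qed.

Lemma johnson_P_curvature (f : V -> R) (L : R) : 0 <= L -> (forall x, 0 < f x) ->
  edge_lipschitz (@johnson_adj n k) L (fun x => ln (f x)) ->
  edge_lipschitz (@johnson_adj n k) L (fun x => ln (kact P f x)).
Proof.
move=> L0 f0 fL x y /adjE_swap[a [b [ax bx ->]]].
have Pf0 := kact_gt0 johnson_P_ge0 johnson_P_sum1 f0.
rewrite lerBlDr -{1}(expRK L) -lnM ?posrE ?expR_gt0// ler_ln ?posrE ?mulr_gt0 ?expR_gt0//.
(* The swap moves each [z] by at most one edge, so [f z <= exp L * f (swap a b z)] pointwise;
   averaging preserves this. *)
rewrite kact_johnson_swap mulr_sumr; apply: ler_sum => z _.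
rewrite mulrCA ler_wpM2l ?johnson_P_ge0//.
rewrite -ler_ln ?posrE ?mulr_gt0 ?expR_gt0// lnM ?posrE ?expR_gt0// expRK -lerBlDr.
by case: (swap_id_or_adj a b z) => [->|/fL//]; rewrite subrr.
Qed.

(* Couple the two walks by applying the swap exchanging their starting points;
   the [n - 2] invariant neighbours and the mass on the edge [x y] itself give
   the coalescence probability [n / 2d]. *)
Lemma johnson_P_wasserstein (phi : V -> R) (L : R) : 0 <= L ->
  edge_lipschitz (@johnson_adj n k) L phi ->
  edge_lipschitz (@johnson_adj n k)
    ((1 - n%:R / (2 * k%:R * (n%:R - k%:R))) * L) (kact P phi).
Proof.
move=> L0 phiL x y xy; have := xy => /adjE_swap[a [b [ax bx yE]]].
rewrite yE kact_johnson_swap /kact -sumrB.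
under eq_bigr do rewrite -mulrBr.
have xny : y != x by rewrite eq_sym; exact: johnson_adj_neq.
have yx : swap a b y = x by rewrite yE swapK.
rewrite (bigD1 x)//= (bigD1 y)//= -yE yx.
have Pxx : P x x = 2^-1 by rewrite PE eqxx.
have Pxy : P x y = (2 * d)^-1 by rewrite PE eq_sym (negbTE xny) xy mul1r.
rewrite Pxx Pxy.
set S := \sum_(i | _) _.
set F := [set z | johnson_adj x z && (swap a b z == z)]%SET.
(* Each invariant neighbour contributes 0 instead of its share [L / 2d]. *)
have HS : S <= \sum_(z | (z != x) && (z != y)) (P x z * L - (z \in F)%:R * (L / (2 * d))).
  apply: ler_sum => z /andP[zx zy]; rewrite !inE.
  have [->|zz] := swap_id_or_adj a b z.
    rewrite eqxx andbT PE eq_sym (negbTE zx) subrr mulr0; lra.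
  rewrite [swap a b z == z]eq_sym (negbTE (johnson_adj_neq zz)) andbF mul0r subr0.
  by rewrite ler_wpM2l ?johnson_P_ge0// phiL.
have S1 : \sum_(z | (z != x) && (z != y)) P x z = 1 - 2^-1 - (2 * d)^-1.
  by have := johnson_P_sum1 x; rewrite (bigD1 x)//= (bigD1 y)//= Pxx Pxy; lra.
have S2 : \sum_(z | (z != x) && (z != y)) (z \in F)%:R = #|F|%:R :> R.
  rewrite -sum1_card natr_sum [RHS]big_mkcond [LHS]big_mkcond.
  apply: eq_bigr => z _; case: (boolP (z \in F)); last by case: ifP.
  rewrite inE => /andP[xz /eqP zz].
  rewrite [z == x]eq_sym (johnson_adj_neq xz)/=; case: eqVneq => // E.
  by move: zz; rewrite E yx => /eqP; rewrite eq_sym (negbTE xny).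
rewrite sumrB -!mulr_suml S1 S2 in HS.
have hF : n%:R - 2 <= #|F|%:R :> R.
  by rewrite -natrB ?ler_nat; [exact: card_fixed_neighbors|move: hk; lia].
rewrite -mulrA dE invfM.
rewrite invfM in HS *.
have d0 : 0 < d by apply: lt_le_trans d_ge1.
have q0 : 0 < d^-1 by rewrite invr_gt0.
have q1 : d^-1 <= 1 by rewrite invf_le1.
have dif := phiL _ _ xy.
set q := d^-1 in q0 q1 HS *; set m := #|F|%:R in hF HS.
(* The terms at [x] and [y] have opposite signs, leaving [1/2 - 1/2d]. The other vertices have mass
   [1/2 - 1/2d], of which at least [(n - 2)/2d] coalesces; the total is [1 - n/2d]. *)
have H1 : (2^-1 - 2^-1 * q) * (phi x - phi y) <= (2^-1 - 2^-1 * q) * L.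
  by rewrite ler_wpM2l//; lra.
have H2 : (n%:R - 2) * (L * (2^-1 * q)) <= m * (L * (2^-1 * q)).
  by rewrite ler_wpM2r// !mulr_ge0//; lra.
by lra.
Qed.

Lemma johnson_entropy_contraction (f : V -> R) : (forall x, 0 <= f x) ->
  \sum_x f x = #|{: V}|%:R ->
  entropy (kact P f) <= (1 - n%:R / (2 * k%:R * (n%:R - k%:R))) * entropy f.
Proof.
move=> f0 fN; apply: (@entropy_contraction _ _ (@johnson_adj n k) _ _ n%:R) => //.
- exact: johnson_P_ge0.
- exact: johnson_P_sum1.
- exact: johnson_P_sym.
- exact: johnson_diam.
- exact: johnson_P_wasserstein.
- exact: johnson_P_curvature.
- rewrite subr_ge0 -mulrA dE ler_pdivrMr.
  by rewrite mul1r /d -natrM ler_nat; move: hk; nia.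
by rewrite mulr_gt0//; apply: lt_le_trans d_ge1.
Qed.

End JohnsonWalk.

(** * Quantitative convexity on two points *)

(** With [s] the square root of [t], [ln s >= 1 - 1/s] gives [(s - 1)^2] as a lower bound for
    [t ln t - t + 1]; the 6 bounds [(s + 1)^2] for [s^2 <= 2]. *)
Lemma sqr_le_mulr_ln (R : realType) (t : R) : 0 <= t <= 2 ->
  (t - 1) ^+ 2 <= 6 * (t * ln t - t + 1).
Proof.
move=> /andP[t0 t2]; pose s := Num.sqrt t.
have s0 : 0 <= s by exact: sqrtr_ge0.
have ts : t = s ^+ 2 by rewrite sqr_sqrtr.
have H : (s - 1) ^+ 2 <= t * ln t - t + 1.
  have [s00|sn0] := eqVneq s 0; first by rewrite ts s00; lra.
  have {}s0 : 0 < s by rewrite lt_def sn0.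
  have ls : ln s >= 1 - s^-1.
    have := @ln_le_subr1 R s^-1; rewrite invr_gt0 lnV ?posrE// => /(_ s0); lra.
  have : s ^+ 2 * ln s >= s ^+ 2 * (1 - s^-1) by rewrite ler_pM2l ?exprn_gt0.
  have -> : s ^+ 2 * (1 - s^-1) = s ^+ 2 - s by field; rewrite gt_eqF.
  by rewrite ts lnXn// mulr2n; lra.
apply: le_trans (_ : 6 * (s - 1) ^+ 2 <= _); last by rewrite ler_pM2l.
have -> : (t - 1) ^+ 2 = (s + 1) ^+ 2 * (s - 1) ^+ 2 by rewrite ts; ring.
by rewrite ler_wpM2r ?sqr_ge0//; nra.
Qed.

(** Rescale by the mean [m]: the ratios lie in [[0, 2]] and sum to 2, so the linear terms cancel
    when the one-variable bound is applied to both. *)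
Lemma sqr_le_two_point_gap (R : realType) (a b B : R) :
  0 <= a -> 0 <= b -> a + b <= B ->
  (a - b) ^+ 2 <= 6 * B * (a * ln a + b * ln b - (a + b) * ln ((a + b) / 2)).
Proof.
move=> a0 b0 abB.
have [ab0|ab0] := leP (a + b) 0.
  have -> : a = 0 by lra.
  have -> : b = 0 by lra.
  by rewrite !(mul0r, addr0, subr0, mulr0) expr0n.
pose m := (a + b) / 2.
have m0 : 0 < m by rewrite /m; lra.
have mE : a + b = 2 * m by rewrite /m; lra.
have lnE (u : R) : 0 <= u -> u * ln u = m * (u / m * ln (u / m)) + u * ln m.
  rewrite le_eqVlt => /predU1P[<-|u0]; first by rewrite !mul0r mulr0 addr0.
  by rewrite ln_div ?posrE//; field; rewrite gt_eqF.
have Ha : (a / m - 1) ^+ 2 <= 6 * (a / m * ln (a / m) - a / m + 1).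
  by apply: sqr_le_mulr_ln; rewrite divr_ge0 ?(ltW m0)//= ler_pdivrMr//; lra.
have Hb : (b / m - 1) ^+ 2 <= 6 * (b / m * ln (b / m) - b / m + 1).
  by apply: sqr_le_mulr_ln; rewrite divr_ge0 ?(ltW m0)//= ler_pdivrMr//; lra.
rewrite -/m (lnE a)// (lnE b)//.
set la := a / m * ln (a / m) in Ha *; set lb := b / m * ln (b / m) in Hb *.
have -> : m * la + a * ln m + (m * lb + b * ln m) - (a + b) * ln m = m * (la + lb) by ring.
have ab2 : a / m + b / m = 2 by rewrite -mulrDl mE mulfK// gt_eqF.
have bE : b / m = 2 - a / m by lra.
rewrite bE in Hb.
set t := a / m in Ha Hb ab2 bE *.
have tE : a = m * t by rewrite /t mulrC divfK// gt_eqF.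
have -> : a - b = 2 * m * (t - 1) by rewrite tE; move: mE; rewrite tE; lra.
have H1 : (t - 1) ^+ 2 <= 3 * (la + lb) by lra.
have H2 : 0 <= la + lb by have := sqr_ge0 (t - 1); lra.
have H3 : 4 * m ^+ 2 * (t - 1) ^+ 2 <= 4 * m ^+ 2 * (3 * (la + lb)).
  by rewrite ler_pM2l//; nra.
have H4 : 2 * m * (m * (la + lb)) <= B * (m * (la + lb)).
  by rewrite ler_wpM2r -?mE// mulr_ge0// ltW.
have -> : (2 * m * (t - 1)) ^+ 2 = 4 * m ^+ 2 * (t - 1) ^+ 2 by ring.
by lra.
Qed.

(** * Divergence from the uniform law and bounds on contraction coefficients *)

Section Uniform.
Context {R : realType} {X : finType}.
Implicit Types (f nu : X -> R).

Lemma dist_to_mean_le f (B : R) : \sum_x f x = #|X|%:R ->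
  (forall x y, f x - f y <= B) -> forall x, `|f x - 1| <= B.
Proof.
move=> fN fB x.
have N0 : 0 < #|X|%:R :> R by rewrite ltr0n; apply/card_gt0P; exists x.
have E : #|X|%:R * (f x - 1) = \sum_y (f x - f y).
  by rewrite sumrB fN sumr_const -mulr_natr; ring.
have E' : #|X|%:R * (1 - f x) = \sum_y (f y - f x).
  by rewrite sumrB fN sumr_const -mulr_natr; ring.
have BE : \sum_(y : X) B = #|X|%:R * B by rewrite sumr_const mulr_natl.
rewrite ler_norml lerNl opprB -(ler_pM2l N0) -(ler_pM2l N0 (f x - 1)) E E' -BE.
by apply/andP; split; apply: ler_sum => y _.
Qed.

(** The chi-square bound: [f ln f <= f (f - 1)], and since [f] has mean 1 the right side sums to the
    variance. *)
Lemma entropy_le_sqr f : (forall x, 0 <= f x) -> \sum_x f x = #|X|%:R ->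
  entropy f <= \sum_x (f x - 1) ^+ 2.
Proof.
move=> f0 fN.
have -> : \sum_x (f x - 1) ^+ 2 = \sum_x f x * (f x - 1).
  apply/eqP; rewrite -subr_eq0 -sumrB; apply/eqP.
  rewrite (eq_bigr (fun x => 1 - f x)) => [|x _]; last by ring.
  by rewrite sumrB fN sumr_const subrr.
apply: ler_sum => x _; have := f0 x; rewrite le_eqVlt => /predU1P[<-|fx].
  by rewrite !mul0r.
by rewrite ler_pM2l// ln_le_subr1.
Qed.

Lemma KL_uniform nu : (0 < #|X|)%N ->
  KL nu (@uniform R X) = (entropy (fun x => #|X|%:R * nu x) / #|X|%:R)%:E.
Proof.
move=> X0; have N0 : #|X|%:R != 0 :> R by rewrite pnatr_eq0 -lt0n.
rewrite /KL ifT; last first.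
  by apply/forallP => x; rewrite /uniform invr_eq0 (negbTE N0).
congr (_%:E); rewrite /entropy mulr_suml; apply: eq_bigr => x _.
by rewrite /uniform invrK [nu x * #|X|%:R]mulrC; field.
Qed.

Lemma sum_scaled_dist nu : is_dist nu -> \sum_x #|X|%:R * nu x = #|X|%:R.
Proof. by case=> _ nu1; rewrite -mulr_sumr nu1 mulr1. Qed.

Lemma contraction_coef_ge (pi : X -> R) (F : (X -> R) -> \bar R) (q : R) :
  (forall nu, is_dist nu ->
     exists a b : R, [/\ F nu = a%:E, KL nu pi = b%:E & a <= (1 - q) * b]) ->
  (q%:E <= 1 - ereal_sup [set F nu / KL nu pi | nu in KL_finite_pos pi]%classic)%E.
Proof.
move=> H; have -> : q = 1 - (1 - q) by ring.
rewrite EFinB; apply: leeB => //; apply: ge_ereal_sup => _ [nu [nud /andP[nu0 _]] <-].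
have [a [b [-> bE ab]]] := H _ nud; rewrite bE lte_fin in nu0 *.
by rewrite inver gt_eqF// -EFinM lee_fin ler_pdivrMr.
Qed.

Lemma contraction_coef_le (pi : X -> R) (F : (X -> R) -> \bar R) nu (a b : R) :
  is_dist nu -> F nu = a%:E -> KL nu pi = b%:E -> 0 < b ->
  (1 - ereal_sup [set F nu / KL nu pi | nu in KL_finite_pos pi]%classic
     <= (1 - a / b)%:E)%E.
Proof.
move=> nud aE bE b0; rewrite EFinB; apply: leeB => //; apply: ereal_sup_ubound.
exists nu; first by split => //; rewrite bE lte_fin b0 ltry.
by rewrite aE bE inver gt_eqF// -EFinM.
Qed.

End Uniform.

Lemma leq_bin n k : (0 < k < n)%N -> (n <= 'C(n, k))%N.
Proof.
elim: n k => [|m IH] [|j]//=; rewrite ltnS => jm; rewrite binS.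
have [<-|jm'] := eqVneq j.+1 m; first by rewrite binn binSn.
by rewrite -addn1 leq_add ?bin_gt0 ?IH//; lia.
Qed.

(** * The half-step coefficient *)

Section JohnsonHalfStep.
Context {R : realType} {n k : nat}.
Hypothesis hk : (1 <= k <= n - 1)%N.
Local Notation V := (johnson_vertex n k).
Local Notation E := (johnson_edge n k).
Local Notation pi := (@johnson_pi R n k).
Local Notation K := (@johnson_K R n k).
Local Notation N := (#|{: V}|%:R : R).
Implicit Types (f nu : V -> R) (e : E) (x y : V).

Let d : R := k%:R * (n%:R - k%:R).

Let dE : d = (k * (n - k))%:R.
Proof. by rewrite /d natrM natrB//; move: hk; lia. Qed.

Let d_gt0 : 0 < d.
Proof. by rewrite dE ltr0n muln_gt0; move: hk; lia. Qed.

Lemma johnson_vertex_gt1 : (1 < #|{: V}|)%N.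
Proof.
by rewrite card_johnson_vertex; apply: leq_trans (leq_bin _); move: hk; lia.
Qed.

Let N_gt0 : 0 < N.
Proof. by rewrite ltr0n; apply: ltnW; exact: johnson_vertex_gt1. Qed.

Lemma sum_edges_sum (F : V -> R) :
  \sum_(e : E) \sum_(x in val e) F x = d * \sum_x F x.
Proof.
under eq_bigr do rewrite big_mkcond.
rewrite exchange_big mulr_sumr; apply: eq_bigr => x _ /=.
rewrite dE -[(k * _)%N](_ : #|common_edges x x| = _); last first.
  by rewrite card_common_edges eqxx.
rewrite -big_mkcond /= mulr_natl -sumr_const; apply: eq_bigl => e.
by rewrite inE andbb.
Qed.

(** Twice the Jensen gap of [u ln u] at the two endpoints of [e]. *)
Definition edge_gap f e : R :=
  \sum_(x in val e) f x * ln (f x)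
  - (\sum_(x in val e) f x) * ln ((\sum_(x in val e) f x) / 2).

Definition total_gap f : R := \sum_(e : E) edge_gap f e.

Lemma push_johnson_K nu e : push nu K e = (\sum_(x in val e) nu x) / d.
Proof.
rewrite /push /johnson_K -/d mulr_suml [RHS]big_mkcond; apply: eq_bigr => x _.
by case: ifP; rewrite ?mul1r// mul0r mulr0.
Qed.

(** Every vertex lies on [d] edges, so the entropy can be rewritten as an edge sum and compared edge
    by edge with the pushed divergence. *)
Lemma KL_half_step nu : KL (push nu K) (push pi K) =
  ((entropy (fun x => N * nu x) - total_gap (fun x => N * nu x) / d) / N)%:E.
Proof.
have piE e : push pi K e = 2 / (N * d).
  rewrite push_johnson_K sumr_const card_johnson_edge /johnson_pi /uniform.
  by rewrite -mulr_natr; field; rewrite !gt_eqF.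
rewrite /KL ifT; last first.
  apply/forallP => e; rewrite piE; apply/implyP.
  by rewrite gt_eqF// divr_gt0// mulr_gt0.
congr (_%:E); set f := fun x => N * nu x.
have -> : entropy f = (\sum_(e : E) \sum_(x in val e) f x * ln (f x)) / d.
  by rewrite sum_edges_sum mulrAC divff ?mul1r// gt_eqF.
rewrite -mulrBl /total_gap /edge_gap -sumrB -mulrA mulr_suml; apply: eq_bigr => e _.
have -> : \sum_(x in val e) f x = N * \sum_(x in val e) nu x by rewrite mulr_sumr.
rewrite piE push_johnson_K; set t := \sum_(x in val e) nu x.
set s := \sum_(x in val e) _ * _.
have -> : t / d / (2 / (N * d)) = N * t / 2.
  by field; rewrite !gt_eqF.
by rewrite opprB addrC subrK; field; rewrite !gt_eqF.
Qed.

Lemma sqr_le_edge_gap f x y e : (forall x, 0 <= f x) -> \sum_x f x = N ->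
  johnson_adj x y -> val e = [set x; y]%SET ->
  (f x - f y) ^+ 2 <= 6 * N * edge_gap f e.
Proof.
move=> f0 fN xy eE.
have E2 F : \sum_(z in val e) F z = F x + F y :> R.
  by rewrite eE big_setU1 ?big_set1// inE johnson_adj_neq.
rewrite /edge_gap !E2; apply: sqr_le_two_point_gap => //.
rewrite -fN -E2 [leRHS](bigID (mem (val e)))/= lerDl.
by rewrite sumr_ge0.
Qed.

Lemma edge_gap_ge0 f e : (forall x, 0 <= f x) -> \sum_x f x = N ->
  0 <= edge_gap f e.
Proof.
move=> f0 fN; have /johnson_edgeP[x [y [xy eE]]] := valP e.
have := sqr_le_edge_gap f0 fN xy eE; have := sqr_ge0 (f x - f y).
by move=> /le_trans/[apply]; rewrite pmulr_rge0// mulr_gt0.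
Qed.

(** The total gap bounds every edge difference of [f], the diameter then bounds its deviation from
    the mean, and the chi-square bound finishes. Only positivity of the resulting coefficient
    matters. *)
Lemma entropy_le_total_gap f : (forall x, 0 <= f x) -> \sum_x f x = N ->
  entropy f <= 6 * n%:R ^+ 2 * N ^+ 2 * total_gap f.
Proof.
move=> f0 fN.
have T0 : 0 <= 6 * N * total_gap f.
  by rewrite !mulr_ge0// ?(ltW N_gt0)// sumr_ge0// => e _; exact: edge_gap_ge0.
pose M := Num.sqrt (6 * N * total_gap f).
have M0 : 0 <= M by exact: sqrtr_ge0.
have fM : edge_lipschitz (@johnson_adj n k) M f.
  move=> x y xy.
  have p : [exists u, exists v, johnson_adj u v && ([set x; y]%SET == [set u; v]%SET)].
    by apply/johnson_edgeP; exists x, y.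
  pose e : E := exist _ [set x; y]%SET p.
  apply: (le_trans (ler_norm _)); rewrite -(ler_sqr (normr_ge0 _) M0)//.
  rewrite -normrX ger0_norm ?sqr_ge0// sqr_sqrtr//.
  apply: (le_trans (sqr_le_edge_gap f0 fN xy (erefl : val e = _))).
  rewrite ler_pM2l ?mulr_gt0// /total_gap (bigD1 e)//= lerDl.
  by rewrite sumr_ge0// => ? _; exact: edge_gap_ge0.
apply: (le_trans (entropy_le_sqr f0 fN)).
have -> : 6 * n%:R ^+ 2 * N ^+ 2 * total_gap f = \sum_(x : V) (n%:R * M) ^+ 2.
  by rewrite sumr_const -mulr_natl exprMn sqr_sqrtr//; ring.
apply: ler_sum => x _; rewrite -[leLHS]ger0_norm ?sqr_ge0// normrX.
rewrite ler_sqr ?nnegrE ?mulr_ge0//.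
by apply: (dist_to_mean_le fN); exact: johnson_diam.
Qed.

Lemma johnson_half_step_pos : exists2 q : R, 0 < q & (q%:E <= half_step pi K)%E.
Proof.
have n0 : 0 < n%:R :> R by rewrite ltr0n; move: hk; lia.
pose B : R := 6 * n%:R ^+ 2 * N ^+ 2 * d.
have B0 : 0 < B by rewrite /B mulr_gt0// !mulr_gt0.
exists B^-1; first by rewrite invr_gt0.
apply: (@contraction_coef_ge _ _ pi (fun nu => KL (push nu K) (push pi K))) => nu nud.
set f := fun x => N * nu x.
exists ((entropy f - total_gap f / d) / N), (entropy f / N); split.
- by rewrite KL_half_step.
- by rewrite KL_uniform// ltnW// johnson_vertex_gt1.
rewrite mulrA ler_pM2r ?invr_gt0//.
suff : B^-1 * entropy f <= total_gap f / d by lra.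
rewrite mulrC ler_pdivrMr// mulrAC /B mulrA mulfK ?gt_eqF// [leRHS]mulrC.
apply: entropy_le_total_gap; last exact: sum_scaled_dist.
by move=> x; rewrite mulr_ge0 ?(ltW N_gt0)//; case: nud.
Qed.

Definition dirac_at x0 : V -> R := fun x => (x == x0)%:R.

Lemma is_dist_dirac_at x0 : is_dist (dirac_at x0).
Proof.
split=> [x|]; first by rewrite /dirac_at.
by rewrite /dirac_at (bigD1 x0)//= eqxx big1 ?addr0// => x /negbTE ->.
Qed.

Lemma KL_dirac_at x0 : KL (dirac_at x0) pi = (ln N)%:E.
Proof.
rewrite KL_uniform; last by rewrite ltnW// johnson_vertex_gt1.
congr (_%:E).
rewrite /entropy (bigD1 x0)//= big1 => [|x /negbTE xx0].
  by rewrite /dirac_at eqxx mulr1 addr0 mulrAC divff ?mul1r// gt_eqF.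
by rewrite /dirac_at xx0 mulr0 mul0r.
Qed.

Lemma johnson_half_step_le : (half_step pi K <= (ln 2 / ln N)%:E)%E.
Proof.
have /card_gt0P[x0 _] : (0 < #|{: V}|)%N by apply: ltnW; exact: johnson_vertex_gt1.
have lN : 0 < ln N by rewrite ln_gt0// ltr1n johnson_vertex_gt1.
pose f x := N * dirac_at x0 x.
have fx0 : f x0 = N by rewrite /f /dirac_at eqxx mulr1.
have fx x : x != x0 -> f x = 0 by move=> /negbTE xx0; rewrite /f /dirac_at xx0 mulr0.
have sumE e (F : V -> R) : (forall x, x != x0 -> F x = 0) ->
    \sum_(x in val e) F x = (x0 \in val e)%:R * F x0.
  move=> F0; rewrite big_mkcond (bigD1 x0)//= big1 => [|x xx0]; last first.
    by rewrite F0//; case: ifP.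
  by rewrite addr0; case: ifP; rewrite ?mul1r ?mul0r.
(* Each of the [d] edges at [x0] carries the values [N] and 0, with gap [N ln 2]; all other edges
   have gap 0. *)
have gapE : total_gap f = d * (N * ln 2).
  have -> : N * ln 2 = \sum_x (x == x0)%:R * (N * ln 2).
    by rewrite -mulr_suml (bigD1 x0)//= eqxx big1 ?addr0 ?mul1r// => x /negbTE ->.
  rewrite -sum_edges_sum; apply: eq_bigr => e _.
  rewrite sumE => [|x /negbTE->]; last by rewrite mul0r.
  rewrite eqxx mul1r /edge_gap (sumE e f)// sumE => [|x /fx->]; last by rewrite mul0r.
  rewrite fx0; case: (x0 \in val e); rewrite ?mul1r ?mul0r ?subrr//.
  by rewrite ln_div ?posrE//; ring.
have -> : ln 2 / ln N = 1 - (ln N - ln 2) / ln N by field; rewrite gt_eqF.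
apply: (@contraction_coef_le _ _ pi (fun nu => KL (push nu K) (push pi K)) (dirac_at x0)) => //.
- exact: is_dist_dirac_at.
- rewrite KL_half_step -/f gapE; congr (_%:E).
  have -> : entropy f = N * ln N.
    rewrite /entropy (bigD1 x0)//= big1 => [|x /fx ->]; last by rewrite mul0r.
    by rewrite fx0 addr0.
  by field; rewrite !gt_eqF.
- exact: KL_dirac_at.
Qed.

(** * The full-step coefficient *)

Lemma johnson_full_step_ge :
  ((n%:R / (2 * k%:R * (n%:R - k%:R)))%:E
     <= full_step pi (@johnson_P R n k))%E.
Proof.
have V0 : (0 < #|{: V}|)%N by apply: ltnW; exact: johnson_vertex_gt1.
apply: (@contraction_coef_ge _ _ pi (fun nu => KL (push nu (@johnson_P R n k)) pi)) => nu nud.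
set f := fun x => N * nu x.
exists (entropy (kact (@johnson_P R n k) f) / N), (entropy f / N); split.
- rewrite KL_uniform//; congr ((_ / _)%:E); apply: eq_bigr => x _.
  (* By symmetry of [P], the density of [nu P] is [P f]. *)
  have -> // : N * push nu (@johnson_P R n k) x = kact (@johnson_P R n k) f x.
  rewrite /push /kact mulr_sumr; apply: eq_bigr => z _.
  by rewrite johnson_P_sym// /f; ring.
- by rewrite KL_uniform.
rewrite mulrA ler_pM2r ?invr_gt0//.
apply: johnson_entropy_contraction => //; last exact: sum_scaled_dist.
by move=> x; rewrite mulr_ge0 ?(ltW N_gt0)//; case: nud.
Qed.

(** Guards against [fine] sending [+oo] to 0 in the final ratio; one admissible [nu], a Dirac mass,
    suffices. *)
Lemma johnson_full_step_ltey : (full_step pi (@johnson_P R n k) < +oo)%E.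
Proof.
have V0 : (0 < #|{: V}|)%N by apply: ltnW; exact: johnson_vertex_gt1.
have /card_gt0P[x0 _] := V0.
have lN : 0 < ln N by rewrite ln_gt0// ltr1n johnson_vertex_gt1.
apply: le_lt_trans (ltry _).
apply: (@contraction_coef_le _ _ pi (fun nu => KL (push nu (@johnson_P R n k)) pi) (dirac_at x0)).
- exact: is_dist_dirac_at.
- exact: KL_uniform.
- exact: KL_dirac_at.
- by [].
Qed.

End JohnsonHalfStep.

Theorem proposition14 (R : realType) :
  (exists C : R, 0 < C /\
     forall n k : nat, (2 <= n)%N -> (1 <= k <= n - 1)%N ->
       (`|half_step (@johnson_pi R n k) (@johnson_K R n k)|
          <= (C / ln ('C(n, k)%:R))%:E)%E)
  /\
  (forall n k : nat, (2 <= n)%N -> (1 <= k <= n - 1)%N ->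
     ((n%:R / (2 * k%:R * (n%:R - k%:R)))%:E
        <= full_step (@johnson_pi R n k) (@johnson_P R n k))%E)
  /\
  (forall k : nat, (1 <= k)%N ->
     exists c : R, 0 < c /\ exists N : nat, forall n : nat, (N <= n)%N ->
       c * ln (n%:R)
         <= fine (full_step (@johnson_pi R n k) (@johnson_P R n k))
              / fine (half_step (@johnson_pi R n k) (@johnson_K R n k))).
Proof.
have ln2 : 0 < ln 2 :> R by rewrite ln_gt0// ltr1n.
split; [|split].
- exists (ln 2); split => // n k _ hk.
  have [q q0 qh] := @johnson_half_step_pos R n k hk.
  rewrite gee0_abs; last by apply: le_trans qh; rewrite lee_fin ltW.
  by rewrite -card_johnson_vertex; exact: johnson_half_step_le.
- by move=> n k _ hk; exact: johnson_full_step_ge.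
- move=> k k1; have k0 : 0 < k%:R :> R by rewrite ltr0n.
  (* Comes from [delta >= 1/2k], as [n/(n - k) >= 1], and [alpha <= ln 2 / ln n], as the binomial is
     at least [n]. *)
  exists (2 * k%:R * ln 2)^-1; split; first by rewrite invr_gt0 !mulr_gt0.
  exists k.+2 => n kn.
  have hk : (1 <= k <= n - 1)%N by lia.
  have nk : 0 < n%:R - k%:R :> R by rewrite subr_gt0 ltr_nat; lia.
  have [q q0 qh] := @johnson_half_step_pos R n k hk.
  have := @johnson_half_step_le R n k hk.
  have := @johnson_full_step_ge R n k hk.
  have := @johnson_full_step_ltey R n k hk.
  (* Two-sided bounds make both coefficients real, so [fine] returns their true values. *)
  case: (half_step _ _) qh => // s; rewrite lee_fin => qs.
  case: (full_step _ _) => // r _; rewrite !lee_fin /= card_johnson_vertex => rge sle.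
  have s0 : 0 < s by apply: lt_le_trans qs.
  have rk : (2 * k%:R)^-1 <= r.
    apply: le_trans rge; rewrite -mulrA invfM [leRHS]mulrC !invfM -!mulrA ler_pM2l ?invr_gt0//.
    by rewrite ler_pMr ?invr_gt0// mulrC ler_pdivlMr//; lra.
  have nC : ln n%:R <= ln 'C(n, k)%:R :> R.
    have nC : (n <= 'C(n, k))%N by apply: leq_bin; lia.
    by rewrite ler_ln ?posrE ?ltr0n ?ler_nat//; lia.
  have ln0 : 0 < ln n%:R :> R by rewrite ln_gt0// ltr1n; lia.
  have {}sle : s * ln 'C(n, k)%:R <= ln 2 by rewrite -ler_pdivlMr//; lra.
  rewrite ler_pdivlMr//; apply: le_trans rk.
  have -> : (2 * k%:R * ln 2)^-1 * ln n%:R * s = (2 * k%:R)^-1 * (ln n%:R * s / ln 2).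
    by field; rewrite !gt_eqF.
  apply: ler_piMr; first by rewrite invr_ge0 mulr_ge0// ltW.
  rewrite ler_pdivrMr// mul1r mulrC.
  by apply: le_trans sle; rewrite ler_pM2l.
Qed.
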